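(* Let $0<q<1$, $k>0$, $s,t>-1$, $x,y\in\mathbb{Z}_{\ge0}$, and $v\in\mathbb{C}$ with $\mathrm{Re}(v)<1+s+t$, such that no denominator below vanishes. Then $P_{\mathrm r}(x,y)=P_{\mathrm r}(x,y;s,t,v,k;q)$ is given by $$P_{\mathrm r}(x,y)=c_1\;{}_4\varphi_3\!\left(\begin{matrix}q^{-2x},\,q^{2x+2s+2k},\,q^{s+t-v+1},\,q^{s-t-v+1}\\ q^{2s+2},\,q^{-2y+s-t-v+1},\,q^{2y+s+t+2k-v+1}\end{matrix};q^2,q^2\right),$$ where $$c_1=\frac{(q^{s+t+2k-v+1};q^2)_\infty}{(q^{s+t-v+1};q^2)_\infty}\,\frac{(q^{-2y+s-t-v+1};q^2)_y}{(q^{s+t+2k-v+1};q^2)_y}\,\frac{(q^{-2x-2s};q^2)_x}{(q^{2k};q^2)_x}.$$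
   Context: $q^z=e^{z\log q}$; $(\alpha;p)_n=\prod_{i=0}^{n-1}(1-\alpha p^i)$, $(\alpha_1,\dots,\alpha_m;p)_n=\prod_i(\alpha_i;p)_n$, $(\alpha;p)_\infty=\lim_{n\to\infty}(\alpha;p)_n$ for $0<p<1$. The ${}_4\varphi_3$ is $\sum_{j=0}^x\frac{(a_1,a_2,a_3,a_4;q^2)_j}{(b_1,b_2,b_3,q^2;q^2)_j}q^{2j}$ with upper parameters $a_i$ and lower parameters $b_i$. Renormalized $q^{-1}$-Al-Salam–Chihara polynomials: for $n,x\in\mathbb{Z}_{\ge0}$, $$\phi_{u,s}(n,x)=q^{n(s-u+\frac12k+\frac12)}\sum_{j=0}^{\min(n,x)}\frac{(q^{2n},\,q^{2x},\,q^{-2x-2s-2k};q^{-2})_j}{(q^{-2k},\,q^{-2};q^{-2})_j}q^{-2j},\qquad w_k(n)=q^{-n(k-1)}\frac{(q^{2k};q^2)_n}{(q^2;q^2)_n}.$$ Overlap coefficient: the absolutely convergent sum (for $\mathrm{Re}(v)<1+s+t$) $$P_{\mathrm r}(x,y;s,t,v,k;q)=\sum_{n=0}^\infty\phi_{1,s}(n,x)\,\phi_{v,t}(n,y)\,w_k(n).$$ *)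

(* Defs.v *)
From HB Require Import structures.
From mathcomp Require Import all_boot all_order all_algebra.
From mathcomp Require Import complex.
From mathcomp Require Import all_classical all_reals all_analysis.

Set Implicit Arguments.
Unset Strict Implicit.
Unset Printing Implicit Defensive.

Import Order.TTheory GRing.Theory Num.Theory.
Import numFieldNormedType.Exports.
Local Open Scope classical_set_scope.
Local Open Scope complex_scope.
Local Open Scope ring_scope.

(* The topology of the numFieldType [R[i]], which the library only attaches to
   abstract numFieldTypes. *)
HB.instance Definition _ (R : rcfType) := NormedModule.copy R[i] R[i]^o.

Section QSeries.
Variable R : realType.
Implicit Types (q : R) (z a p : R[i]).

Definition cexp z : R[i] :=
  (expR (complex.Re z))%:C * (cos (complex.Im z) +i* sin (complex.Im z)).

Definition qpow q z : R[i] := cexp (z * (ln q)%:C).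

Definition qpoch a p (n : nat) : R[i] := \prod_(i < n) (1 - a * p ^+ i).

Definition qpochs (s : seq R[i]) p (n : nat) : R[i] :=
  \prod_(a <- s) qpoch a p n.

Definition qpoch_inf a p : R[i] := limn (qpoch a p).

(* The basic hypergeometric series with upper parameters [aa], lower parameters
   [bb], base [p] and argument [z], summed over [j = 0, ..., N]; this is the
   whole series when [p ^- N] is one of the upper parameters. *)
Definition qhyp_den (bb : seq R[i]) p (j : nat) : R[i] :=
  qpochs (rcons bb p) p j.

Definition qhyp (N : nat) (aa bb : seq R[i]) p z : R[i] :=
  \sum_(j < N.+1) qpochs aa p j / qhyp_den bb p j * z ^+ j.

End QSeries.

Section AlSalamChihara.
Variables (R : realType) (q : R).
Implicit Types (k s t u v : R[i]) (n x y : nat).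

Local Notation Q := (qpow q).

(* Renormalized q^-1-Al-Salam-Chihara polynomials. *)
Definition ascphi k u s n x : R[i] :=
  Q (n%:R * (s - u + k / 2 + 1 / 2)) *
  \sum_(j < (minn n x).+1)
    qpochs [:: Q (2 * n%:R); Q (2 * x%:R); Q (- 2 * x%:R - 2 * s - 2 * k)]
      (Q (- 2)) j
    / qpochs [:: Q (- 2 * k); Q (- 2)] (Q (- 2)) j
    * Q (- 2 * j%:R).

Definition ascweight k n : R[i] :=
  Q (- n%:R * (k - 1)) * (qpoch (Q (2 * k)) (Q 2) n / qpoch (Q 2) (Q 2) n).

Definition overlap_term x y s t v k n : R[i] :=
  ascphi k 1 s n x * ascphi k v t n y * ascweight k n.

Definition overlap x y s t v k : R[i] :=
  limn (series (overlap_term x y s t v k)).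

End AlSalamChihara.

(* Main.v *)
(* With p = q^2, K = q^(2k), S = q^(2s), T = q^(2t), w = q^(s-t-v+1) and
   z = wT, the n-th summand is z^n (K;p)_n/(p;p)_n A(p^n) B(p^n) for polynomials
   A, B in X = p^n that are sums over the Newton basis (X;1/p)_i.  A polynomial
   identity turns A into a little q-Jacobi polynomial, a sum over the powers X^j.
   The q-binomial theorem sums z^n (K;p)_n/(p;p)_n X^j (X;1/p)_i over n, and
   q-Chu-Vandermonde then evaluates the sum over i coming from B, which leaves
   the 4phi3 series over j. *)
Require Import Defs.
From mathcomp Require Import all_boot all_order all_algebra.
From mathcomp Require Import complex.
From mathcomp Require Import all_classical all_reals all_analysis.
From mathcomp Require Import ring lra.
Import Order.TTheory GRing.Theory Num.Theory.
Import numFieldNormedType.Exports.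
Local Open Scope classical_set_scope.
Local Open Scope complex_scope.
Local Open Scope ring_scope.

Set Implicit Arguments.
Unset Strict Implicit.
Unset Printing Implicit Defensive.

(** The two polynomials are treated asymmetrically because the two kinds of factor combine well in
    one sum over [n]. A power [X^j = p^(jn)] only replaces [z] by [z p^j]. A Newton factor
    [(X;1/p)_i] kills the terms with [n < i] and, after a shift of [n], replaces [K] by [K p^i]. The
    factor [(K;p)_i] which this produces cancels the one in the denominator of the coefficients of
    B, and that cancellation is what brings the sum over [i] into Chu-Vandermonde form. Both
    polynomials are finite sums of length independent of [n], so the only exchange of limits is
    linearity of the limit. The identity behind the change of basis is stated without denominators
    in [b] and [c], so that its induction, which moves [b] to [b p] and [X] to [X / p], carries no
    nonvanishing conditions on them; divisions come back only afterwards. *)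

Section QPochhammer.
Variable R : realType.
Implicit Types (a b c p X : R[i]) (m n i j : nat).

Lemma qpoch0 a p : qpoch a p 0 = 1.
Proof. by rewrite /qpoch big_ord0. Qed.

Lemma qpochS a p n : qpoch a p n.+1 = qpoch a p n * (1 - a * p ^+ n).
Proof. by rewrite /qpoch big_ord_recr. Qed.

Lemma qpochSl a p n : qpoch a p n.+1 = (1 - a) * qpoch (a * p) p n.
Proof.
rewrite /qpoch big_ord_recl expr0 mulr1; congr (_ * _).
by apply: eq_bigr => i _; rewrite -mulrA -exprS.
Qed.

Lemma qpochD a p m n : qpoch a p (m + n) = qpoch a p m * qpoch (a * p ^+ m) p n.
Proof.
elim: n => [|n IH]; first by rewrite addn0 qpoch0 mulr1.
by rewrite addnS !qpochS IH -!mulrA -exprD.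
Qed.

Lemma qpoch_base0 p n : qpoch 0 p n = 1.
Proof. by rewrite /qpoch big1 // => i _; rewrite mul0r subr0. Qed.

Lemma qpoch_neq0 a p n :
  (forall i, (i < n)%N -> 1 - a * p ^+ i != 0) -> qpoch a p n != 0.
Proof. by move=> h; apply/prodf_neq0 => i _; apply: h. Qed.

(** The factor of index [n] is [1 - p^n / p^n = 0]. *)
Lemma qpoch_expr_eq0 p n i : p != 0 -> (n < i)%N -> qpoch (p ^+ n) p^-1 i = 0.
Proof.
move=> p0 ni; apply/eqP/prodf_eq0; exists (Ordinal ni) => //=.
by rewrite -exprMn divff// expr1n subrr.
Qed.

End QPochhammer.

(** * Change from the Newton basis to powers of [X], and q-Chu-Vandermonde *)

Section LittleQJacobi.
Variables (R : realType) (p : R[i]).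
Hypotheses (p0 : p != 0) (p1 : forall n, 1 - p ^+ n.+1 != 0).
Implicit Types (b c X : R[i]) (m n i j : nat).

Let pn0 n : p ^+ n != 0. Proof. by rewrite expf_neq0. Qed.

Lemma qpochp_neq0 n : qpoch p p n != 0.
Proof. by apply: qpoch_neq0 => i _; rewrite -exprS. Qed.

(* The signed Gaussian binomial [(-1)^i p^(i(i-1)/2) [n choose i]_p]. *)
Definition sgbin n i : R[i] := qpoch (p ^- n) p i / qpoch p p i * p ^+ n ^+ i.

Lemma sgbin0 n : sgbin n 0 = 1.
Proof. by rewrite /sgbin !qpoch0 divr1 expr0 mulr1. Qed.

Lemma sgbin_out n : sgbin n n.+1 = 0.
Proof. by rewrite /sgbin qpochS mulVf// subrr mulr0 !mul0r. Qed.

Lemma sgbinS n i : sgbin n.+1 i.+1 = sgbin n i.+1 - p ^+ n * sgbin n i.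
Proof.
rewrite /sgbin qpochSl.
have -> : p ^- n.+1 * p = p ^- n by rewrite exprS invfM mulrAC mulVf// mul1r.
rewrite !qpochS -exprS [p ^+ n.+1]exprS [p ^+ i.+1]exprS !exprMn !exprS.
have h := qpochp_neq0 i; have h' := p1 i; rewrite exprS in h'.
move: (qpoch p p i) (qpoch _ p i) h => A B h.
have hn := pn0 n; move: (p ^+ n) hn => P hn.
move: (P ^+ i) => Pi; move: (p ^+ i) h' => pi h'.
by field; rewrite p0 hn h h'.
Qed.

(** The signed Pascal rule puts the factor [p ^+ n] on the shifted term, and no boundary term
    survives because [sgbin n n.+1 = 0]. Both sides of an identity at [n.+1] thus become sums of
    length [n.+1], comparable with the induction hypothesis. *)
Lemma sgbin_sumS n (f : nat -> R[i]) :
  \sum_(i < n.+2) sgbin n.+1 i * f i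
  = \sum_(i < n.+1) sgbin n i * (f i - p ^+ n * f i.+1).
Proof.
transitivity (\sum_(i < n.+1) sgbin n i * f i
              - \sum_(i < n.+1) sgbin n i * (p ^+ n * f i.+1)); last first.
  by rewrite -sumrB; apply: eq_bigr => i _; rewrite mulrBr.
rewrite big_ord_recl sgbin0 /=.
under eq_bigr => i _ do rewrite sgbinS mulrBl.
rewrite sumrB addrA; congr (_ - _); last first.
  by apply: eq_bigr => i _; rewrite mulrAC mulrA mulrC mulrA.
rewrite big_ord_recr /= sgbin_out mul0r addr0.
by rewrite [RHS]big_ord_recl sgbin0.
Qed.

(** For [j <= n] this is [(c;p)_n (p^(1-n))^j / (p^(1-n)/c;p)_j], the product [(c;p)_n] read from
    its last factor, in a form that is polynomial in [c] and needs no division by it. *)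
Definition qpoch_rev c n j : R[i] :=
  qpoch c p (n - j) * \prod_(l < j) (- c / p ^+ l).

Lemma qpoch_revS c n j : (j <= n)%N ->
  qpoch_rev c n.+1 j = (1 - c * p ^+ n / p ^+ j) * qpoch_rev c n j.
Proof.
move=> jn; rewrite /qpoch_rev subSn// qpochS.
have -> : p ^+ (n - j) = p ^+ n / p ^+ j by rewrite expfB_cond// (negPf p0).
by ring.
Qed.

Lemma qpoch_revSS c n j :
  qpoch_rev c n.+1 j.+1 = - c / p ^+ j * qpoch_rev c n j.
Proof. by rewrite /qpoch_rev subSS big_ord_recr /=; ring. Qed.

Lemma qpoch_revE c n j : c != 0 -> (j <= n)%N ->
  qpoch_rev c n j * qpoch (p / (c * p ^+ n)) p j * p ^+ n ^+ j =
  qpoch c p n * p ^+ j.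
Proof.
move=> c0; elim: j => [|j IH] jn.
  by rewrite /qpoch_rev qpoch0 subn0 big_ord0 !mulr1.
have {}IH := IH (ltnW jn).
have E : qpoch_rev c n j = qpoch_rev c n j.+1 * (1 - c * p ^+ (n - j.+1))
   / (- c / p ^+ j).
  rewrite /qpoch_rev -[in LHS](subnSK jn) qpochS big_ord_recr /=.
  by field; rewrite ?oppr_eq0 ?c0 ?pn0.
have En : p ^+ (n - j.+1) = p ^+ n / (p * p ^+ j).
  by rewrite expfB_cond ?(negPf p0)// exprS.
rewrite qpochS [p ^+ j.+1]exprS [RHS]mulrCA -IH E En exprS.
move: (qpoch_rev _ _ _) (qpoch _ _ _) => A B.
have hn := pn0 n; have hj := pn0 j.
move: (p ^+ n) hn => P hn; move: (P ^+ j) => Pj; move: (p ^+ j) hj => pj hj.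
by field; rewrite ?oppr_eq0 ?hn ?hj ?p0 ?c0.
Qed.

(* Both sides satisfy
   [F (n+1) b X = (1 - b c p^n) F n b X - c p^n (1 - b) (1 - X) F n (b p) (X / p)]
   term by term, once the sum over [i < n+2] is contracted by the Pascal
   recursion. *)
Lemma qpoch_transform c n b X :
  \sum_(i < n.+1) sgbin n i *
     (qpoch X p^-1 i * qpoch b p i * qpoch (b * c * p ^+ i) p (n - i) * c ^+ i)
  = \sum_(j < n.+1) sgbin n j * (qpoch b p j * qpoch_rev c n j * X ^+ j).
Proof.
elim: n b X => [|n IH] b X.
  by rewrite !big_ord1 /qpoch_rev !qpoch0 big_ord0 !mulr1.
rewrite (sgbin_sumS _ (fun i => qpoch X p^-1 i * qpoch b p i *
    qpoch (b * c * p ^+ i) p (n.+1 - i) * c ^+ i)).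
rewrite (sgbin_sumS _ (fun j => qpoch b p j * qpoch_rev c n.+1 j * X ^+ j)).
transitivity ((1 - b * c * p ^+ n) * (\sum_(i < n.+1) sgbin n i *
    (qpoch X p^-1 i * qpoch b p i * qpoch (b * c * p ^+ i) p (n - i) * c ^+ i))
  - c * p ^+ n * (1 - b) * (1 - X) * (\sum_(i < n.+1) sgbin n i *
    (qpoch (X / p) p^-1 i * qpoch (b * p) p i *
     qpoch (b * p * c * p ^+ i) p (n - i) * c ^+ i))).
  rewrite !mulr_sumr -sumrB; apply: eq_bigr => i _.
  have ni : (i <= n)%N by rewrite -ltnS.
  rewrite subSS subSn// qpochS -(mulrA (b * c)) -exprD subnKC// [qpoch X _ _.+1]qpochSl
    [qpoch b _ _.+1]qpochSl [c ^+ _.+1]exprS.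
  have -> : b * p * c * p ^+ i = b * c * p ^+ i.+1 by rewrite exprS; ring.
  by ring.
rewrite !IH !mulr_sumr -sumrB; apply: eq_bigr => j _.
have jn : (j <= n)%N by rewrite -ltnS.
rewrite qpoch_revS// qpoch_revSS exprMn.
have E : (1 - b) * qpoch (b * p) p j = qpoch b p j * (1 - b * p ^+ j).
  by rewrite -qpochSl qpochS.
have {}E (a d : R[i]) : a * (1 - b) * d * qpoch (b * p) p j =
   a * d * (qpoch b p j * (1 - b * p ^+ j)) by rewrite -E; ring.
rewrite -exprVn.
transitivity ((1 - b * c * p ^+ n) * (sgbin n j *
   (qpoch b p j * qpoch_rev c n j * X ^+ j)) -
   (c * p ^+ n * (1 - b) * (1 - X) * qpoch (b * p) p j) * (sgbin n j *
    (qpoch_rev c n j * (X ^+ j * p^-1 ^+ j)))); first by ring.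
rewrite E qpochS exprVn exprS.
by field; rewrite pn0.
Qed.

(** The case [X = 0] of [qpoch_transform]: every Newton factor becomes 1 on the left, and only the
    term [j = 0] survives on the right. *)
Lemma qVandermonde c n b :
  \sum_(i < n.+1) sgbin n i *
     (qpoch b p i * qpoch (b * c * p ^+ i) p (n - i) * c ^+ i) = qpoch c p n.
Proof.
transitivity (\sum_(j < n.+1) sgbin n j * (qpoch b p j * qpoch_rev c n j * 0 ^+ j)).
  rewrite -qpoch_transform; apply: eq_bigr => i _.
  by rewrite qpoch_base0 mul1r.
rewrite big_ord_recl big1 => [|i _]; last by rewrite expr0n !mulr0.
by rewrite sgbin0 qpoch0 /qpoch_rev subn0 big_ord0 !mulr1 !mul1r addr0.
Qed.

(* Turns the Al-Salam-Chihara sum into a little q-Jacobi polynomial in [X]. *)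
Lemma little_qjacobi n b c X : c != 0 -> qpoch (b * c) p n != 0 ->
  (forall j, (j <= n)%N -> qpoch (p / (c * p ^+ n)) p j != 0) ->
  \sum_(i < n.+1) qpoch (p ^- n) p i * qpoch b p i /
     (qpoch (b * c) p i * qpoch p p i) * (c * p ^+ n) ^+ i * qpoch X p^-1 i
  = qpoch c p n / qpoch (b * c) p n *
    \sum_(j < n.+1) qpoch (p ^- n) p j * qpoch b p j /
      (qpoch (p / (c * p ^+ n)) p j * qpoch p p j) * (p * X) ^+ j.
Proof.
move=> c0 bc0 h; apply: (mulfI bc0).
rewrite mulrA mulrCA divff// mulr1.
transitivity (\sum_(i < n.+1) sgbin n i *
   (qpoch X p^-1 i * qpoch b p i * qpoch (b * c * p ^+ i) p (n - i) * c ^+ i)).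
  rewrite mulr_sumr; apply: eq_bigr => i _.
  have ni : (i <= n)%N by rewrite -ltnS.
  move: bc0; rewrite -{1 2}(subnKC ni) qpochD mulf_eq0 negb_or => /andP[h1 h2].
  rewrite /sgbin exprMn; field.
  by rewrite h1 qpochp_neq0.
rewrite qpoch_transform mulr_sumr; apply: eq_bigr => j _.
have nj : (j <= n)%N by rewrite -ltnS.
have := qpoch_revE c0 nj => E.
transitivity (qpoch (p ^- n) p j * qpoch b p j /
      (qpoch (p / (c * p ^+ n)) p j * qpoch p p j) * X ^+ j *
      (qpoch c p n * p ^+ j)); last by rewrite exprMn; ring.
rewrite -E /sgbin; field.
by rewrite h// qpochp_neq0.
Qed.

End LittleQJacobi.

(** * Limits and geometrically dominated series in [R[i]] *)

Section ComplexSeries.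
Variable R : realType.
Implicit Types (u w : nat -> R[i]) (f : nat -> R) (M r : R).

(* [R[i]] carries the topology copied in Defs, hence these restatements of the
   limit rules at [R[i]]. *)
Lemma cvg_complexD u w (a b : R[i]) : u @ \oo --> a -> w @ \oo --> b ->
  (fun n => u n + w n) @ \oo --> a + b.
Proof. by move=> hu hw; apply: (@cvgD R[i] R[i]); [exact: hu|exact: hw]. Qed.

Lemma cvg_complexM u w (a b : R[i]) : u @ \oo --> a -> w @ \oo --> b ->
  (fun n => u n * w n) @ \oo --> a * b.
Proof. by move=> hu hw; apply: (@cvgM R[i]); [exact: hu|exact: hw]. Qed.

Lemma cvg_complex_cst (a : R[i]) : (fun _ : nat => a) @ \oo --> a.
Proof. exact: (@cvg_cst R[i]). Qed.

Lemma cvg_complexS u (l : R[i]) :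
  (fun n => u n.+1) @ \oo --> l <-> u @ \oo --> l.
Proof. by split=> h; [rewrite -(@cvg_shiftS R[i])|rewrite (@cvg_shiftS R[i])]; exact: h. Qed.

Lemma cvg_real_complex f (l : R) :
  f @ \oo --> l -> (fun n => (f n)%:C : R[i]) @ \oo --> (l%:C : R[i]).
Proof.
move=> /cvgrPdist_lt h; apply/(@cvgrPdist_lt R[i] R[i]) => e e0.
have eE : e = (complex.Re e)%:C by rewrite RRe_real// gtr0_real.
move: e0; rewrite eE ltcR => /h; apply: filterS => n.
by rewrite -rmorphB normc_def /= expr0n addr0 sqrtr_sqr ltcR.
Qed.

Lemma cvg_real_dominated f M r : 0 <= r < 1 ->
  (forall n, `|f n| <= M * r ^+ n) -> cvgn (series f).
Proof.
move=> /andP[r0 r1] h; apply: normed_cvg.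
apply: (@series_le_cvg _ _ (geometric M r)).
- by move=> n /=.
- by move=> n /=; exact: le_trans (normr_ge0 (f n)) (h n).
- by move=> n /=; exact: h.
- by apply: is_cvg_geometric_series; rewrite ger0_norm.
Qed.

Lemma is_cvg_dominated_series u M r : 0 <= r < 1 ->
  (forall n, `|u n| <= (M * r ^+ n)%:C) ->
  exists l : R[i], series u @ \oo --> l.
Proof.
move=> r01 h.
have hRe : cvgn (series (fun n => complex.Re (u n))).
  apply: (cvg_real_dominated r01) => n; rewrite -lecR.
  exact: le_trans (normc_ge_Re _) (h n).
have hIm : cvgn (series (fun n => complex.Im (u n))).
  apply: (cvg_real_dominated r01) => n; rewrite -lecR.
  (* The imaginary part is, up to sign, the real part of the product with ['i], which has the same
     modulus. *)
  rewrite -normrN -ReiNIm; apply: le_trans (normc_ge_Re _) _.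
  by rewrite normrM [`|'i%C|]normc_def /= expr0n add0r expr1n sqrtr1 mulr1.
eexists.
have -> : series u = (fun n => (series (fun n => complex.Re (u n)) n)%:C
    + 'i%C * (series (fun n => complex.Im (u n)) n)%:C).
  apply/funext => n; rewrite /series /= !rmorph_sum mulr_sumr -big_split /=.
  by apply: eq_bigr => i _; rewrite -complexE.
apply: cvg_complexD; first exact: cvg_real_complex hRe.
apply: cvg_complexM; first exact: (@cvg_complex_cst 'i%C).
exact: cvg_real_complex hIm.
Qed.

Lemma is_cvg_dominated_normed_series u M r : 0 <= r < 1 ->
  (forall n, `|u n| <= (M * r ^+ n)%:C) -> cvgn [normed series u].
Proof.
move=> r01 h.
have hR : cvgn (series (fun n => complex.Re `|u n|)).
  apply: (cvg_real_dominated r01) => n; rewrite -lecR.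
  by apply: le_trans (normc_ge_Re _) _; rewrite normr_id.
have -> : [normed series u] = (fun n => (series (fun n => complex.Re `|u n|) n)%:C).
  apply/funext => n; rewrite /series /= rmorph_sum.
  exact: eq_bigr.
exact: cvgP (cvg_real_complex hR).
Qed.

Lemma cvg_dominated_to_0 u M r : 0 <= r < 1 ->
  (forall n, `|u n| <= (M * r ^+ n)%:C) -> u @ \oo --> (0 : R[i]).
Proof.
move=> r01 h; have [l hl] := is_cvg_dominated_series r01 h.
by apply: (@cvg_series_cvg_0 R[i] R[i]); apply: cvgP hl.
Qed.

Lemma cvg_norm_bound u (l : R[i]) M : u @ \oo --> l ->
  (forall n, `|u n| <= M%:C) -> `|l| <= (M + 1)%:C.
Proof.
move=> /(@cvgrPdist_lt R[i] R[i]) /(_ 1 ltr01) [N _ hN] h.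
have {}hN : `|l - u N| < 1 by apply: hN => /=.
rewrite -[l](subrK (u N)) addrC rmorphD/=; apply: le_trans (ler_normD _ _) _.
by rewrite lerD// ltW.
Qed.

Lemma cvg_unique_complex u (l l' : R[i]) : u @ \oo --> l -> u @ \oo --> l' -> l = l'.
Proof.
have lim_u a : u @ \oo --> a -> limn u = a by move=> h; exact: cvg_lim.
by move=> /lim_u <- /lim_u.
Qed.

End ComplexSeries.

(** * Bounds and convergence of infinite q-Pochhammer products *)

Section InfiniteProducts.
Variable R : realType.
Implicit Types (a z p : R[i]) (C r : R).

Lemma sum_expr_le r n : 0 <= r < 1 -> \sum_(i < n) r ^+ i <= (1 - r)^-1.
Proof.
move=> /andP[r0 r1]; have r1' : 0 < 1 - r by rewrite subr_gt0.
rewrite -[leRHS]mulr1 ler_pdivlMl//.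
have -> : (1 - r) * (\sum_(i < n) r ^+ i) = 1 - r ^+ n.
  by rewrite -[RHS]opprB subrX1 -mulNr opprB.
by rewrite lerBlDr lerDl exprn_ge0.
Qed.

(** Each factor has modulus at most [1 + C r^i <= exp (C r^i)], and the exponents sum to at most
    [C / (1 - r)]. *)
Lemma norm_prod_bound (g : nat -> R[i]) C r : 0 <= r < 1 -> 0 <= C ->
  (forall i, `|g i - 1| <= (C * r ^+ i)%:C) ->
  forall n, `|\prod_(i < n) g i| <= (expR (C / (1 - r)))%:C.
Proof.
move=> r01 C0 h n; rewrite normr_prod.
apply: (@le_trans _ _ (\prod_(i < n) (expR (C * r ^+ i))%:C)).
  apply: ler_prod => i _; rewrite normr_ge0 /=.
  rewrite -[g i](subrK 1); apply: le_trans (ler_normD _ _) _.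
  rewrite normr1 addrC; apply: (@le_trans _ _ (1 + C * r ^+ i)%:C).
    by rewrite rmorphD/= lerD2l.
  by rewrite lecR expR_ge1Dx.
rewrite -rmorph_prod -expR_sum lecR ler_expR -mulr_sumr.
by rewrite ler_wpM2l// sum_expr_le.
Qed.

Lemma normE z : `|z| = (complex.Re `|z|)%:C.
Proof. by rewrite RRe_real// normr_real. Qed.

Lemma Re_norm_ge0 z : 0 <= complex.Re `|z|.
Proof. by rewrite -lecR -normE normr_ge0. Qed.

Lemma Re_norm_itv z : `|z| < 1 -> 0 <= complex.Re `|z| < 1.
Proof. by move=> z1; rewrite -ltcR -lecR -normE normr_ge0. Qed.

Lemma qpoch_bounded a p : `|p| < 1 ->
  exists M : R, forall n, `|qpoch a p n| <= M%:C.
Proof.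
move=> p1; exists (expR (complex.Re `|a| / (1 - complex.Re `|p|))) => n.
apply: (norm_prod_bound (g := fun i => 1 - a * p ^+ i) (Re_norm_itv p1)).
  exact: Re_norm_ge0.
move=> i; rewrite rmorphM rmorphXn /= -!normE.
by rewrite addrAC subrr add0r normrN normrM normrX.
Qed.

Lemma is_cvg_qpoch a p : `|p| < 1 -> qpoch a p @ \oo --> qpoch_inf a p.
Proof.
move=> p1; have [M hM] := qpoch_bounded a p1.
(* The product is telescoped into a series: its increments are [- a p^n (a;p)_n], and boundedness of
   the partial products makes them geometrically small. *)
have [l hl] : exists l : R[i], series (fun n => - (a * p ^+ n) * qpoch a p n) @ \oo --> l.
  apply: (is_cvg_dominated_series (M := complex.Re `|a| * M) (Re_norm_itv p1)) => n.
  rewrite normrM normrN normrM normrX mulrAC !rmorphM rmorphXn /= -!normE.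
  by rewrite ler_wpM2r ?exprn_ge0// ler_wpM2l.
have E : qpoch a p @ \oo --> 1 + l.
  have -> : qpoch a p = (fun n => 1 + series (fun n => - (a * p ^+ n) * qpoch a p n) n).
    apply/funext; elim=> [|n IH]; first by rewrite qpoch0 /series /= big_nil addr0.
    rewrite /series /= in IH *.
    by rewrite qpochS big_nat_recr//= addrA -IH; ring.
  exact: cvg_complexD (@cvg_complex_cst _ _) hl.
by rewrite /qpoch_inf; apply: cvgP E.
Qed.

Lemma qpoch_infD a p n : `|p| < 1 ->
  qpoch_inf a p = qpoch a p n * qpoch_inf (a * p ^+ n) p.
Proof.
move=> p1; apply: (@cvg_unique_complex _ (fun m => qpoch a p (n + m))).
  under eq_fun do rewrite addnC.
  by have := @is_cvg_qpoch a p p1; rewrite -(cvg_shiftn n).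
have -> : (fun m => qpoch a p (n + m)) =
          (fun m => qpoch a p n * qpoch (a * p ^+ n) p m).
  by apply/funext => m; rewrite qpochD.
exact: cvg_complexM (@cvg_complex_cst _ _) (@is_cvg_qpoch _ _ p1).
Qed.

End InfiniteProducts.

(** * The q-binomial theorem, also with a Newton factor inserted *)

Section QBinomial.
Variables (R : realType) (p : R[i]).
Hypothesis p1 : `|p| < 1.
Implicit Types (K z : R[i]) (M : R).

Lemma subr1_expr_neq0 n : 1 - p ^+ n.+1 != 0.
Proof.
rewrite subr_eq0 eq_sym; apply/eqP => pn1.
have : `|p ^+ n.+1| < 1 by rewrite normrX exprn_ilt1.
by rewrite pn1 normr1 ltxx.
Qed.

Definition qbin_coef K n : R[i] := qpoch K p n / qpoch p p n.

Lemma qbin_coef0 K : qbin_coef K 0 = 1.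
Proof. by rewrite /qbin_coef !qpoch0 divr1. Qed.

Lemma qbin_coefS K n :
  qbin_coef K n.+1 * (1 - p ^+ n.+1) = qbin_coef K n * (1 - K * p ^+ n).
Proof.
have h := subr1_expr_neq0 n; have h' := qpochp_neq0 subr1_expr_neq0 n.
rewrite /qbin_coef !qpochS -exprS; move: (p ^+ n.+1) h => P h.
by field; rewrite h h'.
Qed.

(** The quotient is a product of factors differing from 1 by [(p - K) p^i / (1 - p^(i+1))], and
    [|1 - p^(i+1)| >= 1 - |p|]; hence the constant [C]. *)
Lemma qbin_coef_bounded K :
  exists2 M, 0 <= M & forall n, `|qbin_coef K n| <= M%:C.
Proof.
have /andP[r0 r1] := Re_norm_itv p1; set r := complex.Re `|p| in r0 r1.
have r1' : 0 < 1 - r by rewrite subr_gt0.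
pose C := complex.Re `|p - K| / (1 - r).
have C0 : 0 <= C by rewrite divr_ge0 ?Re_norm_ge0// ltW.
exists (expR (C / (1 - r))); first exact: expR_ge0.
move=> n; rewrite /qbin_coef /qpoch -prodf_div.
apply: (norm_prod_bound (g := fun i => (1 - K * p ^+ i) / (1 - p * p ^+ i))) => //.
  by rewrite r0.
move=> i.
have h := subr1_expr_neq0 i; rewrite exprS in h.
have -> : (1 - K * p ^+ i) / (1 - p * p ^+ i) - 1 =
          (p - K) * p ^+ i / (1 - p * p ^+ i) by field.
rewrite normrM normfV normrM normrX mulrAC rmorphM rmorphXn /= -normE.
rewrite ler_wpM2r ?exprn_ge0// /C rmorphM /= -normE ler_wpM2l//.
rewrite fmorphV /= lef_pV2 ?posrE ?normr_gt0//; last by rewrite (ltcR 0).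
rewrite -exprS rmorphB /= -normE; apply: le_trans (lerB_dist _ _).
rewrite normr1 lerD2l lerN2 normrX exprS ler_piMr//.
by rewrite exprn_ile1// ltW.
Qed.

Lemma is_cvg_qbin K z : `|z| < 1 -> forall m,
  exists l : R[i], series (fun n => qbin_coef K (n + m) * z ^+ n) @ \oo --> l.
Proof.
move=> z1 m; have [M M0 hM] := qbin_coef_bounded K.
apply: (is_cvg_dominated_series (M := M) (Re_norm_itv z1)) => n.
by rewrite normrM normrX rmorphM rmorphXn /= -normE ler_wpM2r ?exprn_ge0.
Qed.

(** A truncation of the functional equation [(1 - z) F(z) = (1 - K z) F(p z)] of the q-binomial
    series; the last term is the truncation error, which tends to 0 when [|z| < 1]. *)
Lemma qbin_partial_sum K z n :
  (1 - z) * series (fun n => qbin_coef K n * z ^+ n) n.+1 =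
  (1 - K * z) * series (fun n => qbin_coef K n * (z * p) ^+ n) n.+1
  - qbin_coef K n * (1 - K * p ^+ n) * z ^+ n.+1.
Proof.
rewrite /series /=; elim: n => [|n IH].
  by rewrite !big_nat1 qbin_coef0; ring.
rewrite big_nat_recr//= mulrDr IH [in RHS]big_nat_recr//= [in RHS]mulrDr.
have := qbin_coefS K n; rewrite exprMn !exprS => E.
have -> : (1 - z) * (qbin_coef K n.+1 * (z * z ^+ n)) =
  qbin_coef K n.+1 * (1 - p * p ^+ n) * (z * z ^+ n) +
  qbin_coef K n.+1 * (p * p ^+ n - z) * (z * z ^+ n) by ring.
by rewrite E; ring.
Qed.

Lemma qbin_functional_eq K z (l l' : R[i]) : `|z| < 1 ->
  series (fun n => qbin_coef K n * z ^+ n) @ \oo --> l ->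
  series (fun n => qbin_coef K n * (z * p) ^+ n) @ \oo --> l' ->
  (1 - z) * l = (1 - K * z) * l'.
Proof.
move=> z1 hl hl'; have [M M0 hM] := qbin_coef_bounded K.
have h0 : (fun n => qbin_coef K n.+1 * (1 - p ^+ n.+1) * z ^+ n.+1) @ \oo --> (0 : R[i]).
  (* The 2 bounds [|1 - p^(n+1)|]. *)
  apply: (cvg_dominated_to_0 (M := M * 2) (Re_norm_itv z1)) => n.
  rewrite normrM (normrM (qbin_coef _ _)) normrX !rmorphM rmorphXn /= -normE
    [`|z| ^+ _.+1]exprS.
  apply: ler_pM; rewrite ?mulr_ge0 ?exprn_ge0//; last first.
    by rewrite ler_piMl ?exprn_ge0// ltW.
  apply: ler_pM; rewrite ?normr_ge0// rmorph_nat.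
  apply: le_trans (ler_normB _ _) _; rewrite normr1 lerD2l normrX.
  by rewrite exprn_ile1// ltW.
apply: (@cvg_unique_complex _ (fun n => (1 - z) *
   series (fun n => qbin_coef K n * z ^+ n) n.+1)).
  exact: cvg_complexM (@cvg_complex_cst _ _) ((cvg_complexS _ _).2 hl).
under eq_fun do rewrite qbin_partial_sum -qbin_coefS.
rewrite -[(1 - K * z) * l']addr0; apply: cvg_complexD.
  exact: cvg_complexM (@cvg_complex_cst _ _) ((cvg_complexS _ _).2 hl').
under eq_fun do rewrite -mulN1r.
by have := cvg_complexM (@cvg_complex_cst _ (-1 : R[i])) h0; rewrite mulr0.
Qed.

(** Splitting off the constant term gives [l = 1 + w g], where [g] is a shifted series bounded
    uniformly for [|w| <= |z|]; the extra 1 in the witness is the slack of [cvg_norm_bound]. This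
    quantitative continuity at 0 is applied to [w = z p^m]. *)
Lemma qbin_near1 K z : `|z| < 1 -> exists M, forall w l, `|w| <= `|z| ->
  series (fun n => qbin_coef K n * w ^+ n) @ \oo --> l -> `|l - 1| <= M%:C * `|w|.
Proof.
move=> z1; have [M M0 hM] := qbin_coef_bounded K.
have rz := Re_norm_itv z1; have /andP[r0 r1] := rz.
set r := complex.Re `|z| in rz r0 r1.
exists (M / (1 - r) + 1) => w l wz hl.
have w1 : `|w| < 1 := le_lt_trans wz z1.
have [g hg] := is_cvg_qbin K w1 1.
have -> : l = 1 + w * g.
  apply: (@cvg_unique_complex _ (fun n =>
    series (fun n => qbin_coef K n * w ^+ n) n.+1)).
    exact: (cvg_complexS _ _).2 hl.
  have -> : (fun n => series (fun n => qbin_coef K n * w ^+ n) n.+1) =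
    (fun n => 1 + w * series (fun n => qbin_coef K (n + 1) * w ^+ n) n).
    apply/funext => n; rewrite /series /= big_nat_recl//= qbin_coef0 mulr1.
    congr (_ + _); rewrite mulr_sumr; apply: eq_bigr => i _.
    by rewrite addn1 exprS mulrCA.
  exact: cvg_complexD (@cvg_complex_cst _ _) (cvg_complexM (@cvg_complex_cst _ _) hg).
rewrite addrAC subrr add0r normrM mulrC ler_wpM2r//.
apply: cvg_norm_bound hg _ => n; rewrite /series /= big_mkord.
apply: le_trans (ler_norm_sum _ _ _) _.
apply: (@le_trans _ _ (M * \sum_(i < n) r ^+ i)%:C); last first.
  by rewrite lecR ler_wpM2l// sum_expr_le.
rewrite mulr_sumr rmorph_sum; apply: ler_sum => i _ /=.
rewrite normrM normrX rmorphM rmorphXn /= -normE.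
by apply: ler_pM; rewrite ?exprn_ge0// lerXn2r// nnegrE.
Qed.

(** With [F m] the sum at [z p^m], iterating the functional equation gives
    [(z;p)_m F 0 = (K z;p)_m F m]. As [m] grows, [F m] tends to 1 and the products tend to their
    infinite versions. *)
Lemma cvg_qbinomial K z : `|z| < 1 -> qpoch_inf z p != 0 ->
  series (fun n => qbin_coef K n * z ^+ n) @ \oo -->
  qpoch_inf (K * z) p / qpoch_inf z p.
Proof.
move=> z1 z0.
have zp1 m : `|z * p ^+ m| <= `|z|.
  by rewrite normrM normrX ler_piMr// exprn_ile1// ltW.
have hz m : exists l : R[i],
   series (fun n => qbin_coef K n * (z * p ^+ m) ^+ n) @ \oo --> l.
  have [l hl] := is_cvg_qbin K (le_lt_trans (zp1 m) z1) 0.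
  by exists l; under [fun n => _ * _]eq_fun do rewrite -[X in qbin_coef _ X]addn0.
have [F hF] := choice hz.
have FS m : qpoch z p m * F 0%N = qpoch (K * z) p m * F m.
  elim: m => [|m IH]; first by rewrite !qpoch0.
  have E := qbin_functional_eq (le_lt_trans (zp1 m) z1) (hF m).
  have := hF m.+1; rewrite exprSr mulrA => /E {}E.
  rewrite !qpochS mulrAC IH.
  transitivity (qpoch (K * z) p m * ((1 - z * p ^+ m) * F m)); first by ring.
  by rewrite E; ring.
have [M hM] := qbin_near1 K z1.
have F1 : F @ \oo --> (1 : R[i]).
  have -> : F = (fun m => 1 + (F m - 1)) by apply/funext => m; rewrite addrC subrK.
  suff h : (fun m => F m - 1) @ \oo --> (0 : R[i]).
    by have := cvg_complexD (@cvg_complex_cst _ (1 : R[i])) h; rewrite addr0.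
  apply: (cvg_dominated_to_0 (M := M * complex.Re `|z|) (Re_norm_itv p1)) => m.
  apply: le_trans (hM _ _ (zp1 m) (hF m)) _.
  by rewrite normrM normrX !rmorphM rmorphXn /= -!normE mulrA.
suff E : qpoch_inf z p * F 0%N = qpoch_inf (K * z) p.
  have -> : qpoch_inf (K * z) p / qpoch_inf z p = F 0%N.
    by rewrite -E mulrAC divff// mul1r.
  by have := hF 0%N; rewrite expr0 mulr1.
rewrite -[RHS]mulr1; apply: (@cvg_unique_complex _ (fun m => qpoch z p m * F 0%N)).
  exact: cvg_complexM (@is_cvg_qpoch _ z _ p1) (@cvg_complex_cst _ (F 0%N)).
under eq_fun do rewrite FS.
exact: cvg_complexM (@is_cvg_qpoch _ (K * z) _ p1) F1.
Qed.

(** Each step on [i] uses that the first Newton factor [1 - p^n] vanishes at [n = 0]. Dropping that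
    term and shifting [n], the factor is absorbed by [qbin_coef K n.+1 * (1 - p^(n+1)) = qbin_coef
    (K p) n * (1 - K)]. *)
Lemma cvg_qbinomial_shift K z i : `|z| < 1 -> qpoch_inf z p != 0 -> p != 0 ->
  series (fun n => qbin_coef K n * z ^+ n * qpoch (p ^+ n) p^-1 i) @ \oo -->
  z ^+ i * qpoch K p i * qpoch_inf (K * p ^+ i * z) p / qpoch_inf z p.
Proof.
move=> z1 z0 p0; elim: i K => [|i IH] K.
  rewrite qpoch0 expr0 !mulr1 mul1r.
  under [fun n => _ * _]eq_fun do rewrite qpoch0 mulr1.
  exact: cvg_qbinomial.
apply/cvg_complexS.
have -> : (fun n => series (fun n => qbin_coef K n * z ^+ n * qpoch (p ^+ n) p^-1 i.+1) n.+1)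
  = (fun n => z * (1 - K) *
       series (fun n => qbin_coef (K * p) n * z ^+ n * qpoch (p ^+ n) p^-1 i) n).
  apply/funext => n; rewrite /series /= big_nat_recl//= [qpoch _ _ i.+1]qpochSl.
  rewrite subrr mul0r mulr0 add0r mulr_sumr; apply: eq_bigr => j _.
  have E : qbin_coef K j.+1 * (1 - p ^+ j.+1) = qbin_coef (K * p) j * (1 - K).
    rewrite /qbin_coef [qpoch K _ _]qpochSl [qpoch p p _.+1]qpochS -exprS.
    field.
    by rewrite subr1_expr_neq0 qpochp_neq0//; exact: subr1_expr_neq0.
  rewrite qpochSl.
  have -> : p ^+ j.+1 / p = p ^+ j by rewrite exprSr mulfK.
  transitivity (qbin_coef K j.+1 * (1 - p ^+ j.+1) * z ^+ j.+1 * qpoch (p ^+ j) p^-1 i).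
    by ring.
  by rewrite E exprS; ring.
have -> : z ^+ i.+1 * qpoch K p i.+1 * qpoch_inf (K * p ^+ i.+1 * z) p / qpoch_inf z p =
  z * (1 - K) * (z ^+ i * qpoch (K * p) p i *
   qpoch_inf (K * p * p ^+ i * z) p / qpoch_inf z p).
  by rewrite qpochSl [p ^+ i.+1]exprS [K * (p * _)]mulrA exprS; ring.
exact: cvg_complexM (@cvg_complex_cst _ _) (IH _).
Qed.

End QBinomial.

(** * Summation of the overlap series in the variables [p], [K], [S], [T], [w] *)

Section Overlap.
Variables (R : realType) (p K : R[i]).
Hypotheses (p0 : p != 0) (p1 : `|p| < 1) (K0 : forall n, qpoch K p n != 0).
Implicit Types (S T w z a : R[i]).

Let pn0 n : p ^+ n != 0. Proof. by rewrite expf_neq0. Qed.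
Let pp0 n : qpoch p p n != 0. Proof. exact/qpochp_neq0/subr1_expr_neq0. Qed.
Let K_neq0 n : 1 - K * p ^+ n != 0.
Proof. by have := K0 n.+1; rewrite qpochS mulf_eq0 negb_or => /andP[]. Qed.

Definition asc_coef x S i : R[i] :=
  qpoch (p ^- x) p i * qpoch (p ^+ x * S * K) p i / (qpoch K p i * qpoch p p i) *
  S^-1 ^+ i.

Definition asc_poly x S n : R[i] :=
  \sum_(i < x.+1) asc_coef x S i * qpoch (p ^+ n) p^-1 i.

(** Factors are inverted by [1 - 1/(a p^i) = -(1 - a p^i) / (a p^i)]. With two of them above and two
    below, signs and powers of [p^i] cancel and [p / S] remains per step; its [p] cancels against
    the argument [p^-1]. *)
Lemma asc_coefE x S i : K != 0 -> S != 0 ->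
  qpoch (p ^+ x) p^-1 i * qpoch (p ^+ x * S * K)^-1 p^-1 i /
    (qpoch K^-1 p^-1 i * qpoch p^-1 p^-1 i) * p^-1 ^+ i = asc_coef x S i.
Proof.
move=> Kn0 Sn0; rewrite /asc_coef.
elim: i => [|i IH]; first by rewrite !qpoch0 !expr0 !mulr1.
rewrite !qpochS ![_ ^+ i.+1]exprSr !exprVn.
have h1 := K_neq0 i; have h2 := subr1_expr_neq0 p1 i; rewrite exprS in h2.
have hx := pn0 x; have hi := pn0 i.
transitivity ((qpoch (p ^+ x) p^-1 i * qpoch (p ^+ x * S * K)^-1 p^-1 i /
    (qpoch K^-1 p^-1 i * qpoch p^-1 p^-1 i) * p^-1 ^+ i) *
   ((1 - p ^+ x / p ^+ i) * (1 - (p ^+ x * S * K)^-1 / p ^+ i) /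
    ((1 - K^-1 / p ^+ i) * (1 - p^-1 / p ^+ i)) / p)).
  by rewrite exprVn !invfM; ring.
rewrite IH exprVn; set J := p ^+ i in h1 h2 hi *; set P := p ^+ x in hx *.
have -> : (1 - P / J) * (1 - (P * S * K)^-1 / J) / ((1 - K^-1 / J) * (1 - p^-1 / J)) / p
  = (1 - P^-1 * J) * (1 - P * S * K * J) / ((1 - K * J) * (1 - p * J)) / S.
  field.
  by rewrite h1 h2 hx hi p0 Kn0 Sn0 /= -[p * J - 1]opprB -[K * J - 1]opprB
    !oppr_eq0 h1 h2.
by rewrite !invfM; ring.
Qed.

(** [little_qjacobi] with [b = p^x S K] and [c = 1/(p^x S)], chosen so that [b c = K] and
    [c p^x = 1/S]. The power [X^j] is written [(p^j)^n], ready to merge with [z^n]. *)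
Lemma asc_polyE x S n : S != 0 -> (forall j, (j <= x)%N -> qpoch (S * p) p j != 0) ->
  asc_poly x S n = qpoch (p ^+ x * S)^-1 p x / qpoch K p x *
    \sum_(j < x.+1) qpoch (p ^- x) p j * qpoch (p ^+ x * S * K) p j /
      (qpoch (S * p) p j * qpoch p p j) * p ^+ j * (p ^+ j) ^+ n.
Proof.
move=> S0 h; have c0 : (p ^+ x * S)^-1 != 0 by rewrite invr_eq0 mulf_neq0.
have E1 : p ^+ x * S * K * (p ^+ x * S)^-1 = K by field; rewrite S0 pn0.
have E2 : (p ^+ x * S)^-1 * p ^+ x = S^-1 by field; rewrite S0 pn0.
have E3 : p / S^-1 = S * p by rewrite invrK mulrC.
have := little_qjacobi p0 (subr1_expr_neq0 p1) (n := x) (b := p ^+ x * S * K)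
  (p ^+ n) c0; rewrite E1 E2 E3 => /(_ (K0 x) h) E.
rewrite /asc_poly /asc_coef E; congr (_ * _); apply: eq_bigr => j _.
by rewrite exprMn mulrA -!exprM [(n * j)%N]mulnC.
Qed.

Lemma cvg_series_lincomb (m : nat) (a : nat -> R[i]) (u : nat -> nat -> R[i])
    (l : nat -> R[i]) : (forall i, (i < m)%N -> series (u i) @ \oo --> l i) ->
  series (fun n => \sum_(i < m) a i * u i n) @ \oo --> \sum_(i < m) a i * l i.
Proof.
elim: m => [|m IH] h.
  rewrite big_ord0.
  have -> : series (fun n => \sum_(i < 0) a i * u i n) = (fun=> 0 : R[i]).
    by apply/funext => n; rewrite /series /= big1// => i _; rewrite big_ord0.
  exact: (@cvg_complex_cst _ _).
have -> : series (fun n => \sum_(i < m.+1) a i * u i n) =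
  (fun n => series (fun n => \sum_(i < m) a i * u i n) n + a m * series (u m) n).
  apply/funext => n; rewrite /series /= mulr_sumr -big_split /=.
  by apply: eq_bigr => i _; rewrite big_ord_recr.
rewrite big_ord_recr /=; apply: cvg_complexD.
  by apply: IH => i im; apply: h; rewrite ltnW.
exact: cvg_complexM (@cvg_complex_cst _ _) (h m (ltnSn m)).
Qed.

(** All the infinite products in the numerators share the tail starting at [w T K p^(y+j)];
    extracting it leaves finite products of length [y - i]. The rest is [qVandermonde] with
    [b = p^y T K] and [c = w p^j / p^y], for which [b c p^i = K p^i (w T p^j)]. *)
Lemma asc_Vandermonde y T w j : T != 0 ->
  \sum_(i < y.+1) asc_coef y T i *
    ((w * T * p ^+ j) ^+ i * qpoch K p i *
     qpoch_inf (K * p ^+ i * (w * T * p ^+ j)) p / qpoch_inf (w * T * p ^+ j) p)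
  = qpoch (w / p ^+ y * p ^+ j) p y *
    (qpoch_inf (w * T * K * p ^+ y * p ^+ j) p / qpoch_inf (w * T * p ^+ j) p).
Proof.
move=> T0; rewrite -(qVandermonde p0 (subr1_expr_neq0 p1) _ _ (p ^+ y * T * K)).
rewrite mulr_suml; apply: eq_bigr => i _.
have iy : (i <= y)%N by rewrite -ltnS.
have -> : p ^+ y * T * K * (w / p ^+ y * p ^+ j) * p ^+ i = K * p ^+ i * (w * T * p ^+ j).
  by field.
have -> : qpoch_inf (K * p ^+ i * (w * T * p ^+ j)) p =
   qpoch (K * p ^+ i * (w * T * p ^+ j)) p (y - i) *
   qpoch_inf (w * T * K * p ^+ y * p ^+ j) p.
  have E : K * p ^+ i * (w * T * p ^+ j) * p ^+ (y - i) = w * T * K * p ^+ y * p ^+ j.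
    by rewrite -[in RHS](subnKC iy) exprD; ring.
  by rewrite (qpoch_infD _ (y - i) p1) E.
have -> : w / p ^+ y * p ^+ j = (w * T * p ^+ j) / (T * p ^+ y).
  by field; rewrite T0 pn0.
rewrite /asc_coef /sgbin [(_ / (T * _)) ^+ i]exprMn ![_^-1 ^+ i]exprVn
  [(T * _) ^+ i]exprMn.
have h1 := K0 i; have h2 := pp0 i.
have hT : T ^+ i != 0 by rewrite expf_neq0.
have hp : p ^+ y ^+ i != 0 by rewrite expf_neq0.
move: (qpoch K p i) (qpoch p p i) (T ^+ i) (p ^+ y ^+ i) h1 h2 hT hp.
move: ((w * T * p ^+ j) ^+ i) (qpoch_inf (w * T * p ^+ j) p)^-1 => X Y A B C D hA hB hC hD.
by field; rewrite hA hB hC hD.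
Qed.

Lemma cvg_overlap x y S T w : S != 0 -> T != 0 ->
  `|w * T| < 1 -> qpoch_inf (w * T) p != 0 ->
  (forall j, (j <= x)%N -> qpoch (S * p) p j != 0) ->
  (forall j, (j <= x)%N -> qpoch (w / p ^+ y) p j != 0) ->
  (forall j, (j <= x)%N -> qpoch (w * T * K * p ^+ y) p j != 0) ->
  qpoch (w * T * K) p y != 0 ->
  series (fun n => qbin_coef p K n * (w * T) ^+ n * (asc_poly x S n * asc_poly y T n))
  @ \oo -->
  qpoch_inf (w * T * K) p / qpoch_inf (w * T) p *
  (qpoch (w / p ^+ y) p y / qpoch (w * T * K) p y) *
  (qpoch (p ^+ x * S)^-1 p x / qpoch K p x) *
  \sum_(j < x.+1) qpoch (p ^- x) p j * qpoch (p ^+ x * S * K) p j *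
      qpoch (w * T) p j * qpoch w p j /
     (qpoch (S * p) p j * qpoch (w / p ^+ y) p j *
      qpoch (w * T * K * p ^+ y) p j * qpoch p p j) * p ^+ j.
Proof.
move=> S0 T0 z1 z0 hS hw hz hzy; set z := w * T in z1 z0 hz hzy *.
pose C := qpoch (p ^+ x * S)^-1 p x / qpoch K p x.
pose al j := C * (qpoch (p ^- x) p j * qpoch (p ^+ x * S * K) p j /
      (qpoch (S * p) p j * qpoch p p j) * p ^+ j).
have -> : (fun n => qbin_coef p K n * z ^+ n * (asc_poly x S n * asc_poly y T n)) =
  (fun n => \sum_(j < x.+1) al j * \sum_(i < y.+1) asc_coef y T i *
     (qbin_coef p K n * (z * p ^+ j) ^+ n * qpoch (p ^+ n) p^-1 i)).
  apply/funext => n; rewrite asc_polyE// -/C -(mulrA C) mulr_suml !mulr_sumr.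
  apply: eq_bigr => j _; rewrite /al /asc_poly !mulr_sumr; apply: eq_bigr => i _.
  by rewrite [(z * _) ^+ n]exprMn; ring.
have z0j j : qpoch z p j != 0 /\ qpoch_inf (z * p ^+ j) p != 0.
  by apply/andP; rewrite -negb_or -mulf_eq0 -qpoch_infD.
have zj1 j : `|z * p ^+ j| < 1.
  by apply: le_lt_trans z1; rewrite normrM normrX ler_piMr// exprn_ile1// ltW.
pose L j := qpoch (w / p ^+ y * p ^+ j) p y *
    (qpoch_inf (z * K * p ^+ y * p ^+ j) p / qpoch_inf (z * p ^+ j) p).
have hL j : series (fun n => \sum_(i < y.+1) asc_coef y T i *
     (qbin_coef p K n * (z * p ^+ j) ^+ n * qpoch (p ^+ n) p^-1 i)) @ \oo --> L j.
  rewrite /L /z -asc_Vandermonde//.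
  apply: (cvg_series_lincomb (u := fun i n => qbin_coef p K n * (z * p ^+ j) ^+ n *
     qpoch (p ^+ n) p^-1 i) (l := fun i => (z * p ^+ j) ^+ i * qpoch K p i *
     qpoch_inf (K * p ^+ i * (z * p ^+ j)) p / qpoch_inf (z * p ^+ j) p)) => i _.
  by apply: (cvg_qbinomial_shift p1) => //; case: (z0j j).
have := @cvg_series_lincomb x.+1 al _ L (fun j _ => hL j).
congr (_ --> _); rewrite -/C mulr_sumr; apply: eq_bigr => j _.
have jx : (j <= x)%N by rewrite -ltnS.
have [h1 h2] := z0j j.
rewrite /al /L.
(* [(w/p^y;p)_(y+j)] is split both after [y] and after [j] factors. This is where the upper
   parameter [w] and the lower parameter [w/p^y] arise; [E2] and [E3] yield the other pair depending
   on [z]. *)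
have E1 : qpoch (w / p ^+ y * p ^+ j) p y =
   qpoch (w / p ^+ y) p y * qpoch w p j / qpoch (w / p ^+ y) p j.
  apply: (mulfI (hw j jx)); rewrite -qpochD addnC qpochD mulrCA mulfV ?hw// mulr1.
  by congr (_ * qpoch _ _ _); rewrite divfK.
have E2 : qpoch_inf (z * K * p ^+ y * p ^+ j) p =
   qpoch_inf (z * K) p / (qpoch (z * K) p y * qpoch (z * K * p ^+ y) p j).
  rewrite (qpoch_infD (z * K) y p1) (qpoch_infD (z * K * p ^+ y) j p1).
  by field; rewrite hzy hz.
have E3 : qpoch_inf (z * p ^+ j) p = qpoch_inf z p / qpoch z p j.
  by rewrite (qpoch_infD z j p1); field.
rewrite E1 E2 E3; field.
by rewrite h1 z0 hzy !hz// !hw// !hS// pp0.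
Qed.

End Overlap.

(** * Boundedness of the polynomial factors, for absolute convergence *)

Section BoundedSequences.
Variable R : realType.
Implicit Types (u w : nat -> R[i]) (p K : R[i]).

Definition bounded_seq u := exists2 M : R, 0 <= M & forall n, `|u n| <= M%:C.

Lemma bounded_seq_cst (a : R[i]) : bounded_seq (fun=> a).
Proof. by exists (complex.Re `|a|) => [|n]; [exact: Re_norm_ge0|rewrite -normE]. Qed.

Lemma bounded_seqM u w : bounded_seq u -> bounded_seq w -> bounded_seq (fun n => u n * w n).
Proof.
move=> [M M0 hM] [N N0 hN]; exists (M * N) => [|n]; first exact: mulr_ge0.
by rewrite normrM rmorphM ler_pM.
Qed.

Lemma bounded_seqD u w : bounded_seq u -> bounded_seq w -> bounded_seq (fun n => u n + w n).
Proof.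
move=> [M M0 hM] [N N0 hN]; exists (M + N) => [|n]; first exact: addr_ge0.
by apply: le_trans (ler_normD _ _) _; rewrite rmorphD lerD.
Qed.

Lemma bounded_seq_asc_poly p K x S : `|p| < 1 -> bounded_seq (asc_poly p K x S).
Proof.
move=> p1.
have hp : bounded_seq (fun n => p ^+ n).
  by exists 1 => // n; rewrite normrX exprn_ile1// ltW.
have hq i : bounded_seq (fun n => qpoch (p ^+ n) p^-1 i).
  elim: i => [|i IH].
    by under eq_fun do rewrite qpoch0; exact: bounded_seq_cst.
  under eq_fun do rewrite qpochS -mulNr.
  apply: bounded_seqM IH _; apply: bounded_seqD; first exact: bounded_seq_cst.
  under eq_fun do rewrite -mulN1r -mulrA.
  apply: bounded_seqM; first exact: bounded_seq_cst.
  by apply: bounded_seqM => //; exact: bounded_seq_cst.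
rewrite /asc_poly; elim: x.+1 (asc_coef p K x S) => [|m IH] a.
  by under eq_fun do rewrite big_ord0; exact: bounded_seq_cst.
under eq_fun do rewrite big_ord_recr /=.
by apply: bounded_seqD => //; apply: bounded_seqM => //; exact: bounded_seq_cst.
Qed.

End BoundedSequences.

(** * Powers of [q], and translation of the summand into [p], [K], [S], [T] *)

Section QPower.
Variables (R : realType) (q : R).
Implicit Types (a b : R[i]).

Local Notation Q := (qpow q).

Lemma qpowD a b : Q (a + b) = Q a * Q b.
Proof.
case: a => a1 a2; case: b => b1 b2; rewrite /qpow /cexp.
apply/eqP; rewrite eq_complex /= !mulr0 !mul0r !subr0 !addr0 !add0r.
rewrite !(mulrDl _ _ (ln q)) expRD cosD sinD.
by apply/andP; split; apply/eqP; ring.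
Qed.

Lemma norm_qpow a : `|Q a| = (expR (complex.Re a * ln q))%:C.
Proof.
case: a => a1 a2; rewrite /qpow /cexp normrM.
rewrite [X in X * _]normc_def [X in _ * X]normc_def /= cos2Dsin2 sqrtr1 expr0n addr0.
by rewrite sqrtr_sqr ger0_norm ?expR_ge0// mulr0 subr0 mulr1.
Qed.

Lemma qpow_neq0 a : Q a != 0.
Proof.
rewrite -normr_gt0 norm_qpow (ltcR 0); exact: expR_gt0.
Qed.

Lemma qpow0 : Q 0 = 1.
Proof.
apply: (mulfI (qpow_neq0 0)).
by rewrite -qpowD addr0 mulr1.
Qed.

Lemma qpowN a : Q (- a) = (Q a)^-1.
Proof.
by apply: (mulfI (qpow_neq0 a)); rewrite -qpowD subrr qpow0 divff// qpow_neq0.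
Qed.

Lemma qpow_natM n a : Q (n%:R * a) = Q a ^+ n.
Proof.
elim: n => [|n IH]; first by rewrite mul0r qpow0.
by rewrite -addn1 natrD mulrDl mul1r qpowD IH exprD expr1.
Qed.

Lemma norm_qpow_lt1 a : 0 < q < 1 -> 0 < complex.Re a -> `|Q a| < 1.
Proof.
move=> q01 a0; rewrite norm_qpow (ltcR _ 1) -expR0 ltr_expR.
by rewrite nmulr_llt0// ln_lt0.
Qed.

Lemma ascphiE k u s n x : `|Q 2| < 1 -> (forall i, qpoch (Q (2 * k)) (Q 2) i != 0) ->
  ascphi q k u s n x =
  Q (s - u + k / 2 + 1 / 2) ^+ n * asc_poly (Q 2) (Q (2 * k)) x (Q (2 * s)) n.
Proof.
move=> p1 K0; rewrite /ascphi qpow_natM; congr (_ * _).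
have Qx m : Q (2 * m%:R) = Q 2 ^+ m by rewrite mulrC qpow_natM.
pose F j := asc_coef (Q 2) (Q (2 * k)) x (Q (2 * s)) j * qpoch (Q 2 ^+ n) (Q 2)^-1 j.
rewrite /asc_poly; transitivity (\sum_(j < (minn n x).+1) F j).
  apply: eq_bigr => j _.
  rewrite /qpochs !big_cons !big_nil !mulr1 /F -asc_coefE ?qpow_neq0//.
  have -> : Q (- 2 * x%:R - 2 * s - 2 * k) = (Q 2 ^+ x * Q (2 * s) * Q (2 * k))^-1.
    by rewrite -Qx -!qpowD -qpowN; congr (Q _); ring.
  rewrite ![- 2 * _]mulNr !qpowN !Qx exprVn !invfM.
  ring.
(* For [n < j <= x] the Newton factor vanishes, so the range up to [minn n x] extends to [x] and no
   longer depends on [n]. *)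
rewrite -[RHS]/(\sum_(j < x.+1) F j) -!(big_mkord xpredT F).
rewrite [RHS](big_cat_nat (n := (minn n x).+1)) ?ltnS ?geq_minr//=.
rewrite [X in _ = _ + X]big_nat [X in _ = _ + X]big1 ?addr0// => j /andP[].
rewrite gtn_min => /orP[] hj jx; rewrite /F; last first.
  by rewrite ltnS leqNgt hj in jx.
by rewrite qpoch_expr_eq0 ?qpow_neq0// mulr0.
Qed.

Lemma overlap_termE x y s t v k n : `|Q 2| < 1 -> (forall i, qpoch (Q (2 * k)) (Q 2) i != 0) ->
  overlap_term q x y s t v k n =
  qbin_coef (Q 2) (Q (2 * k)) n * Q (s + t - v + 1) ^+ n *
  (asc_poly (Q 2) (Q (2 * k)) x (Q (2 * s)) n * asc_poly (Q 2) (Q (2 * k)) y (Q (2 * t)) n).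
Proof.
move=> p1 K0; rewrite /overlap_term !ascphiE// /ascweight mulNr -mulrN (qpow_natM n) /qbin_coef.
(* The two shifts [k/2 + 1/2] add up to [k + 1]; the weight contributes [-(k - 1)] and [u = 1]
   contributes [-1], so [k] drops out. *)
have -> : Q (s + t - v + 1) =
    Q (s - 1 + k / 2 + 1 / 2) * Q (t - v + k / 2 + 1 / 2) * Q (- (k - 1)).
  by rewrite -!qpowD; congr (Q _); field.
by rewrite [(_ * Q (- _)) ^+ n]exprMn [(Q (s - 1 + _ + _) * _) ^+ n]exprMn; ring.
Qed.

End QPower.

Theorem corollary4p2 (R : realType) (q k s t : R) (v : R[i]) (x y : nat) :
  let kc := k%:C in let sc := s%:C in let tc := t%:C in
  let xc : R[i] := x%:R in let yc : R[i] := y%:R in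
  let Q := qpow q in
  let p := Q 2 in
  let upper := [:: Q (- 2 * xc); Q (2 * xc + 2 * sc + 2 * kc);
                   Q (sc + tc - v + 1); Q (sc - tc - v + 1)] in
  let lower := [:: Q (2 * sc + 2); Q (- 2 * yc + sc - tc - v + 1);
                   Q (2 * yc + sc + tc + 2 * kc - v + 1)] in
  let c1 := qpoch_inf (Q (sc + tc + 2 * kc - v + 1)) p
              / qpoch_inf (Q (sc + tc - v + 1)) p
            * (qpoch (Q (- 2 * yc + sc - tc - v + 1)) p y
              / qpoch (Q (sc + tc + 2 * kc - v + 1)) p y)
            * (qpoch (Q (- 2 * xc - 2 * sc)) p x / qpoch (Q (2 * kc)) p x) in
  0 < q < 1 -> 0 < k -> -1 < s -> -1 < t ->
  complex.Re v < 1 + s + t ->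
  (forall j : nat, (j <= x)%N -> qhyp_den lower p j != 0) ->
  qpoch_inf (Q (sc + tc - v + 1)) p != 0 ->
  qpoch (Q (sc + tc + 2 * kc - v + 1)) p y != 0 ->
  qpoch (Q (2 * kc)) p x != 0 ->
  cvgn [normed series (overlap_term q x y sc tc v kc)] /\
  overlap q x y sc tc v kc = c1 * qhyp x upper lower p p.
Proof.
move=> kc sc tc xc yc Q p upper lower c1 q01 k0 s1 t1 hv hden hz0 hzy hK.
set z := Q (sc + tc - v + 1) in hz0 *; pose K := Q (2 * kc).
pose S := Q (2 * sc); pose T := Q (2 * tc); pose w := Q (sc - tc - v + 1).
have Qn (m : nat) : Q (m%:R * 2) = p ^+ m by rewrite /Q qpow_natM.
have p0 : p != 0 := qpow_neq0 _ _.
have p1 : `|p| < 1.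
  by apply: norm_qpow_lt1 => //=.
have K1 : `|K| < 1.
  apply: norm_qpow_lt1 => //; have -> : 2 * kc = (2 * k)%:C by rewrite rmorphM rmorph_nat.
  by rewrite /= mulr_gt0.
(* Positivity of [k] gives [|K p^i| <= |K| < 1], so [K p^i] is never 1. *)
have K0 n : qpoch K p n != 0.
  apply: qpoch_neq0 => i _; rewrite subr_eq0 eq_sym; apply/eqP => E.
  suff : `|K * p ^+ i| < 1 by rewrite E normr1 ltxx.
  rewrite normrM normrX; apply: le_lt_trans K1.
  by rewrite ler_piMr// exprn_ile1// ltW.
have zE : z = w * T by rewrite /z /w /T /Q -qpowD; congr qpow; ring.
(* The bound on the real part of [v] says that the exponent of [z] has positive real part. *)
have z1 : `|z| < 1.
  by apply: norm_qpow_lt1 => //; rewrite !raddfD raddfN /=; lra.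
have E1 : Q (2 * sc + 2) = S * p by rewrite /Q qpowD.
have E2 : Q (- 2 * yc + sc - tc - v + 1) = w / p ^+ y.
  by rewrite -Qn /w /Q -qpowN -qpowD; congr qpow; rewrite /yc; ring.
have E3 : Q (2 * yc + sc + tc + 2 * kc - v + 1) = w * T * K * p ^+ y.
  by rewrite -Qn /w /T /K /Q -!qpowD; congr qpow; rewrite /yc; ring.
have E4 : Q (sc + tc + 2 * kc - v + 1) = w * T * K.
  by rewrite /w /T /K /Q -!qpowD; congr qpow; ring.
have E5 : Q (- 2 * xc - 2 * sc) = (p ^+ x * S)^-1.
  by rewrite -Qn /S /Q -qpowD -qpowN; congr qpow; rewrite /xc; ring.
have E6 : Q (- 2 * xc) = p ^- x.
  by rewrite -Qn /Q -qpowN; congr qpow; rewrite /xc; ring.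
have E7 : Q (2 * xc + 2 * sc + 2 * kc) = p ^+ x * S * K.
  by rewrite -Qn /S /K /Q -!qpowD; congr qpow; rewrite /xc; ring.
have termE n : overlap_term q x y sc tc v kc n =
    qbin_coef p K n * z ^+ n * (asc_poly p K x S n * asc_poly p K y T n).
  exact: (@overlap_termE R q x y sc tc v kc n p1 K0).
split.
  (* Apart from [z^n] the summand is bounded, so [|z| < 1] gives geometric domination. *)
  have [M M0 hM] : bounded_seq
      (fun n => qbin_coef p K n * (asc_poly p K x S n * asc_poly p K y T n)).
    apply: bounded_seqM; first exact: qbin_coef_bounded.
    by apply: bounded_seqM; exact: bounded_seq_asc_poly.
  apply: (is_cvg_dominated_normed_series (M := M) (Re_norm_itv z1)) => n.
  have -> : (M * complex.Re `|z| ^+ n)%:C = M%:C * `|z| ^+ n.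
    by rewrite [in RHS](normE z) rmorphM rmorphXn.
  rewrite termE mulrAC normrM normrX.
  by rewrite ler_wpM2r ?exprn_ge0.
have hd j : (j <= x)%N -> [/\ qpoch (S * p) p j != 0, qpoch (w / p ^+ y) p j != 0 &
    qpoch (w * T * K * p ^+ y) p j != 0].
  move=> /hden; rewrite /qhyp_den /qpochs /lower /= !big_cons E1 E2 E3 !mulf_eq0 !negb_or.
  by move=> /and4P[].
have zw1 : `|w * T| < 1 by rewrite -zE.
have zw0 : qpoch_inf (w * T) p != 0 by rewrite -zE.
have hzy' : qpoch (w * T * K) p y != 0 by rewrite -E4.
have cv := cvg_overlap p0 p1 K0 (x := x) (y := y) (S := S) (T := T) (w := w)
  (qpow_neq0 _ _) (qpow_neq0 _ _) zw1 zw0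
  (fun j jx => let: And3 h _ _ := hd j jx in h)
  (fun j jx => let: And3 _ h _ := hd j jx in h)
  (fun j jx => let: And3 _ _ h := hd j jx in h) hzy'.
rewrite /overlap.
have -> : overlap_term q x y sc tc v kc = fun n =>
    qbin_coef p K n * (w * T) ^+ n * (asc_poly p K x S n * asc_poly p K y T n).
  by apply/funext => n; rewrite termE zE.
rewrite (cvg_lim _ cv)//.
rewrite /c1 /qhyp /qhyp_den /qpochs /upper /lower E1 E2 E3 E4 E5 E6 E7 -/K -/z -/w zE.
congr (_ * _); apply: eq_bigr => j _.
by rewrite /= !big_cons !big_nil !mulr1 !mulrA.
Qed.
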